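(* Let $R$ and $S$ be arbitrary (associative) rings with unit. If the structures $\langle \mathrm{Cn},R\rangle$ and $\langle \mathrm{Cn},S\rangle$ are equivalent in the second-order logic $L_2$, then the categories $\textup{mod-}R$ and $\textup{mod-}S$ are elementarily equivalent.
   Context: The ambient set theory is NBG (von Neumann--Bernays--G\''odel, with choice). $\mathrm{Cn}$ is the class of all cardinal numbers (initial ordinals; a cardinal is identified with the set of smaller ordinals). $\textup{mod-}R$ is the category of all left $R$-modules and all homomorphisms. The first order language of category theory has variables for objects and for morphisms, equality, and expressions for ''$f\in \mathrm{Mor}(X,Y)$'', ''$h=f\circ g$'' and ''$f=1_X$''. Two categories are elementarily equivalent if the same sentences of this language hold in both. The second-order logic $L_2$ of the structure $\langle \mathrm{Cn},\mathsf{ring}\rangle$ (where $\mathsf{ring}$ stands for a ring, with its operations $+$ and $\cdot$): formulas are built by the logical connectives from: quantifiers $\forall r\in\mathsf{ring}$, $\exists r\in \mathsf{ring}$; quantifiers $\forall\varkappa\in\mathrm{Cn}$, $\exists\varkappa\in\mathrm{Cn}$; quantifiers $\forall\alpha\in\varkappa$, $\exists\alpha\in\varkappa$, where $\varkappa$ is a free or previously introduced cardinal variable; atomic formulas $r_1=r_2+r_3$, $r_1=r_2\cdot r_3$, $r_1=r_2$, $\varkappa_1=\varkappa_2$, $\alpha_1=\alpha_2$; quantifiers $\forall$, $\exists$ over predicate variables $P_{\varkappa_1,\dots,\varkappa_k}(c_1,\dots,c_k;v_1,\dots,v_n)$, where $\varkappa_1,\dots,\varkappa_k$ are free or previously introduced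 cardinal variables, ranging over arbitrary relations $P\subseteq \varkappa_1\times\dots\times\varkappa_k\times \mathsf{ring}^n$; and atomic formulas $P_{\varkappa_1,\dots,\varkappa_k}(\alpha_1,\dots,\alpha_k;r_1,\dots,r_n)$ with $\alpha_i\in\varkappa_i$, $r_j\in \mathsf{ring}$. Structures $\langle \mathrm{Cn},R\rangle$ and $\langle \mathrm{Cn},S\rangle$ are equivalent in $L_2$ if the same sentences of this language are true in both. *)

(* Defs.v *)
From HB Require Import structures.
From mathcomp Require Import all_boot all_order all_algebra.
From mathcomp Require Import boolp.

Set Implicit Arguments.
Unset Strict Implicit.
Unset Printing Implicit Defensive.

Import GRing.Theory.

(** * Sets, ordinals, cardinals *)

(* The ambient set theory is interpreted in Aczel's cumulative hierarchy over
   the universe of the index types A, quotiented by bisimilarity so that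
   equality of sets is Leibniz equality.  With classical logic and choice it
   satisfies ZFC, and together with its predicates [zset -> Prop] as classes
   it satisfies NBG. *)
Inductive pset : Type := PSet (A : Type) (f : A -> pset).

Fixpoint psim (x y : pset) : Prop :=
  match x, y with
  | PSet A f, PSet B g =>
      (forall a, exists b, psim (f a) (g b)) /\
      (forall b, exists a, psim (f a) (g b))
  end.

Definition pmem (x y : pset) : Prop :=
  let: PSet B g := y in exists b, psim x (g b).

Lemma psim_refl x : psim x x.
Proof. by elim: x => A f IH; split=> a; exists a. Qed.

Lemma psim_sym x y : psim x y -> psim y x.
Proof.
elim: x y => A f IH [B g] /= [fg gf].
by split=> [b|a]; [case: (gf b) => a | case: (fg a) => b];
  [exists a | exists b]; apply: IH.
Qed.

Lemma psim_trans y x z : psim x y -> psim y z -> psim x z.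
Proof.
elim: y x z => B g IH [A f] [C h] /= [fg gf] [gh hg].
split=> [a|c].
  by have [b /IH fb] := fg a; have [c /fb] := gh b; exists c.
by have [b bc] := hg c; have [a ab] := gf b; exists a; apply: IH bc.
Qed.

Definition zset : Type := {C : pset -> Prop | exists x, C = psim x}.

Definition zset_of (x : pset) : zset := exist _ (psim x) (ex_intro _ x erefl).

Definition zin (x y : zset) : Prop :=
  exists u v : pset, [/\ x = zset_of u, y = zset_of v & pmem u v].

Definition zempty : zset := zset_of (PSet (fun i : False => match i with end)).

Definition elt (x : zset) : Type := {y : zset | zin y x}.

(* Membership is well founded, so its totality on a transitive set makes that
   set well ordered by membership. *)
Definition is_ordinal (x : zset) : Prop :=
  (forall y z, zin y x -> zin z y -> zin z x) /\
  (forall y z, zin y x -> zin z x -> [\/ zin y z, y = z | zin z y]).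

Definition equinumerous (x y : zset) : Prop :=
  exists f : elt x -> elt y, bijective f.

Definition is_cardinal (x : zset) : Prop :=
  is_ordinal x /\ forall y, zin y x -> ~ equinumerous y x.

(** * Rings and modules *)

(* A ring is a set with a ring structure.  [pzRingType] is the class of unital
   associative rings, the zero ring included. *)
Record zring : Type := ZRing {
  ring_set : zset;
  ring_class : GRing.PzRing (elt ring_set)
}.

Definition zring_pzRing (R : zring) : pzRingType :=
  GRing.PzRing.Pack (ring_class R).
Coercion zring_pzRing : zring >-> GRing.PzRing.type.

Record module (R : pzRingType) : Type := Module {
  mod_set : zset;
  mod_zero : elt mod_set;
  mod_opp : elt mod_set -> elt mod_set;
  mod_add : elt mod_set -> elt mod_set -> elt mod_set;
  mod_scale : R -> elt mod_set -> elt mod_set;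
  mod_addA : associative mod_add;
  mod_addC : commutative mod_add;
  mod_add0 : left_id mod_zero mod_add;
  mod_addN : left_inverse mod_zero mod_opp mod_add;
  mod_scaleA : forall a b x, mod_scale a (mod_scale b x) = mod_scale (a * b)%R x;
  mod_scale1 : left_id 1%R mod_scale;
  mod_scaleDr : right_distributive mod_scale mod_add;
  mod_scaleDl : forall x a b,
    mod_scale (a + b)%R x = mod_add (mod_scale a x) (mod_scale b x)
}.

(* A [module] is an [lmodType] on a set without the additional choice structure
   of [lmodType], which is recovered here classically; thus Leibniz equality of
   modules is equality of the underlying sets and of the operations. *)
Definition mod_sort (R : pzRingType) (M : module R) : Type := elt (mod_set M).
HB.instance Definition _ (R : pzRingType) (M : module R) :=
  Choice.copy (mod_sort M) {classic elt (mod_set M)}.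
HB.instance Definition _ (R : pzRingType) (M : module R) :=
  GRing.isZmodule.Build (mod_sort M)
    (@mod_addA R M) (@mod_addC R M) (@mod_add0 R M) (@mod_addN R M).
HB.instance Definition _ (R : pzRingType) (M : module R) :=
  GRing.Zmodule_isLmodule.Build R (mod_sort M)
    (@mod_scaleA R M) (@mod_scale1 R M) (@mod_scaleDr R M) (@mod_scaleDl R M).

(** * Categories *)

Record category : Type := Category {
  obj : Type;
  hom : obj -> obj -> Type;
  idm : forall X, hom X X;
  comp : forall X Y Z, hom Y Z -> hom X Y -> hom X Z;
  comp_idl : forall X Y (f : hom X Y), comp (idm Y) f = f;
  comp_idr : forall X Y (f : hom X Y), comp f (idm X) = f;
  comp_assoc : forall X Y Z T (f : hom Z T) (g : hom Y Z) (h : hom X Y),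
    comp f (comp g h) = comp (comp f g) h
}.

Record arrow (C : category) : Type := Arrow {
  dom : obj C;
  cod : obj C;
  arr : hom dom cod
}.
Arguments Arrow {C dom cod} arr.

Definition mod_hom (R : pzRingType) (M N : module R) : Type :=
  {linear mod_sort M -> mod_sort N}.

Definition mod_id (R : pzRingType) (M : module R) : mod_hom M M :=
  [the {linear _ -> _} of idfun].

Definition mod_comp (R : pzRingType) (M N P : module R)
    (f : mod_hom N P) (g : mod_hom M N) : mod_hom M P :=
  [the {linear _ -> _} of f \o g].

Lemma mod_hom_eq (R : pzRingType) (M N : module R) (f g : mod_hom M N) :
  (forall x, f x = g x) -> f = g.
Proof.
case: f g => f [[fD] [fZ]] [g [[gD] [gZ]]] /= /funext fg; subst g.
by rewrite (Prop_irrelevance gD fD) (Prop_irrelevance gZ fZ).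
Qed.

Definition modcat (R : pzRingType) : category :=
  @Category (module R) (@mod_hom R) (@mod_id R) (@mod_comp R)
    (fun M N f => @mod_hom_eq R M N (mod_comp (mod_id N) f) f (fun=> erefl))
    (fun M N f => @mod_hom_eq R M N (mod_comp f (mod_id M)) f (fun=> erefl))
    (fun M N P Q f g h => @mod_hom_eq R M Q
       (mod_comp f (mod_comp g h)) (mod_comp (mod_comp f g) h) (fun=> erefl)).

(** * The first-order language of categories *)

(* Formulas with n object variables and m morphism variables in scope.
   Variables are numbered by order of introduction: a quantifier over objects
   binds variable number n in its body. *)
Inductive cat_form (n m : nat) : Type :=
| CObjEq (X Y : 'I_n)
| CMorEq (f g : 'I_m)
| CInMor (f : 'I_m) (X Y : 'I_n)
| CIsComp (h f g : 'I_m)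
| CIsId (f : 'I_m) (X : 'I_n)
| CNot (phi : cat_form n m)
| CAnd (phi psi : cat_form n m)
| COr (phi psi : cat_form n m)
| CImp (phi psi : cat_form n m)
| CAllObj (phi : cat_form n.+1 m)
| CExObj (phi : cat_form n.+1 m)
| CAllMor (phi : cat_form n m.+1)
| CExMor (phi : cat_form n m.+1).

Fixpoint cat_sat (C : category) (n m : nat) (phi : cat_form n m) :
    n.-tuple (obj C) -> m.-tuple (arrow C) -> Prop :=
  match phi with
  | CObjEq X Y => fun o a => tnth o X = tnth o Y
  | CMorEq f g => fun o a => tnth a f = tnth a g
  | CInMor f X Y => fun o a =>
      dom (tnth a f) = tnth o X /\ cod (tnth a f) = tnth o Y
  | CIsComp h f g => fun o a =>
      exists (X Y Z : obj C) (u : hom Y Z) (v : hom X Y),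
        [/\ tnth a f = Arrow u, tnth a g = Arrow v
          & tnth a h = Arrow (comp u v)]
  | CIsId f X => fun o a => tnth a f = Arrow (idm (tnth o X))
  | CNot phi => fun o a => ~ cat_sat phi o a
  | CAnd phi psi => fun o a => cat_sat phi o a /\ cat_sat psi o a
  | COr phi psi => fun o a => cat_sat phi o a \/ cat_sat psi o a
  | CImp phi psi => fun o a => cat_sat phi o a -> cat_sat psi o a
  | CAllObj phi => fun o a => forall X, cat_sat phi [tuple of rcons o X] a
  | CExObj phi => fun o a => exists X, cat_sat phi [tuple of rcons o X] a
  | CAllMor phi => fun o a => forall f, cat_sat phi o [tuple of rcons a f]
  | CExMor phi => fun o a => exists f, cat_sat phi o [tuple of rcons a f]
  end.

Definition elementarily_equivalent (C D : category) : Prop :=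
  forall phi : cat_form 0 0,
    @cat_sat C 0 0 phi [tuple] [tuple] <-> @cat_sat D 0 0 phi [tuple] [tuple].

(** * The second-order logic of cardinals and a ring *)

(* Variables of each of the four sorts (ring elements, cardinals, elements of
   cardinals, predicates) are numbered separately, by order of introduction
   along the path from the root of the formula. *)
Inductive l2_form : Type :=
| LRingAdd (r1 r2 r3 : nat)
| LRingMul (r1 r2 r3 : nat)
| LRingEq (r1 r2 : nat)
| LCardEq (k1 k2 : nat)
| LOrdEq (a1 a2 : nat)
| LPred (P : nat) (al : seq nat) (rl : seq nat)
| LNot (phi : l2_form)
| LAnd (phi psi : l2_form)
| LOr (phi psi : l2_form)
| LImp (phi psi : l2_form)
| LAllRing (phi : l2_form)
| LExRing (phi : l2_form)
| LAllCard (phi : l2_form)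
| LExCard (phi : l2_form)
| LAllOrd (k : nat) (phi : l2_form)
| LExOrd (k : nat) (phi : l2_form)
| LAllPred (kl : seq nat) (n : nat) (phi : l2_form)
| LExPred (kl : seq nat) (n : nat) (phi : l2_form).

(* The variables in scope: for an element of a cardinal, the number of the
   cardinal variable bounding it; for a predicate, the cardinal variables in its
   subscript and its number of ring arguments. *)
Record l2_ctx : Type := L2Ctx {
  cring : nat;
  ccard : nat;
  cord : seq nat;
  cpred : seq (seq nat * nat)
}.

Definition l2_ctx0 : l2_ctx := L2Ctx 0 0 [::] [::].

Definition ctx_ring (c : l2_ctx) : l2_ctx :=
  L2Ctx (cring c).+1 (ccard c) (cord c) (cpred c).
Definition ctx_card (c : l2_ctx) : l2_ctx :=
  L2Ctx (cring c) (ccard c).+1 (cord c) (cpred c).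
Definition ctx_ord (c : l2_ctx) (k : nat) : l2_ctx :=
  L2Ctx (cring c) (ccard c) (rcons (cord c) k) (cpred c).
Definition ctx_pred (c : l2_ctx) (kl : seq nat) (n : nat) : l2_ctx :=
  L2Ctx (cring c) (ccard c) (cord c) (rcons (cpred c) (kl, n)).

(* In an application of a predicate variable, the i-th ordinal argument must
   have been introduced as an element of the i-th cardinal of the subscript. *)
Fixpoint l2_wf (c : l2_ctx) (phi : l2_form) : bool :=
  let R r := (r < cring c) in
  let K k := (k < ccard c) in
  let A a := (a < size (cord c)) in
  match phi with
  | LRingAdd r1 r2 r3 | LRingMul r1 r2 r3 => [&& R r1, R r2 & R r3]
  | LRingEq r1 r2 => R r1 && R r2
  | LCardEq k1 k2 => K k1 && K k2
  | LOrdEq a1 a2 => A a1 && A a2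
  | LPred P al rl =>
      [&& (P < size (cpred c)), all A al, all R rl &
          nth ([::], 0) (cpred c) P
            == ([seq nth 0 (cord c) a | a <- al], size rl)]
  | LNot phi => l2_wf c phi
  | LAnd phi psi | LOr phi psi | LImp phi psi => l2_wf c phi && l2_wf c psi
  | LAllRing phi | LExRing phi => l2_wf (ctx_ring c) phi
  | LAllCard phi | LExCard phi => l2_wf (ctx_card c) phi
  | LAllOrd k phi | LExOrd k phi => K k && l2_wf (ctx_ord c k) phi
  | LAllPred kl n phi | LExPred kl n phi =>
      all K kl && l2_wf (ctx_pred c kl n) phi
  end.

Definition l2_sentence (phi : l2_form) : bool := l2_wf l2_ctx0 phi.

Definition relation_value (R : pzRingType) : Type := seq zset -> seq R -> Prop.

(* [P] is a subset of the product of the sets in [ks] and of n copies of R. *)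
Definition is_relation (R : pzRingType) (ks : seq zset) (n : nat)
    (P : relation_value R) : Prop :=
  forall al rl, P al rl ->
    [/\ size al = size ks,
        forall i, (i < size ks) -> zin (nth zempty al i) (nth zempty ks i)
      & size rl = n].

Record l2_env (R : pzRingType) : Type := L2Env {
  ering : seq R;
  ecard : seq zset;
  eord : seq zset;
  epred : seq (relation_value R)
}.

Definition l2_env0 (R : pzRingType) : l2_env R := L2Env [::] [::] [::] [::].

Section Semantics.
Context (R : pzRingType).

Definition env_ring (e : l2_env R) (r : R) : l2_env R :=
  L2Env (rcons (ering e) r) (ecard e) (eord e) (epred e).
Definition env_card (e : l2_env R) (k : zset) : l2_env R :=
  L2Env (ering e) (rcons (ecard e) k) (eord e) (epred e).
Definition env_ord (e : l2_env R) (a : zset) : l2_env R :=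
  L2Env (ering e) (ecard e) (rcons (eord e) a) (epred e).
Definition env_pred (e : l2_env R) (P : relation_value R) : l2_env R :=
  L2Env (ering e) (ecard e) (eord e) (rcons (epred e) P).

Definition ring_of (e : l2_env R) (r : nat) : R := nth 0%R (ering e) r.
Definition card_of (e : l2_env R) (k : nat) : zset := nth zempty (ecard e) k.
Definition ord_of (e : l2_env R) (a : nat) : zset := nth zempty (eord e) a.
Definition pred_of (e : l2_env R) (P : nat) : relation_value R :=
  nth (fun _ _ => False) (epred e) P.

(* The default values of [nth] are never reached in well-formed formulas. *)
Fixpoint l2_sat (e : l2_env R) (phi : l2_form) : Prop :=
  match phi with
  | LRingAdd r1 r2 r3 => ring_of e r1 = (ring_of e r2 + ring_of e r3)%R
  | LRingMul r1 r2 r3 => ring_of e r1 = (ring_of e r2 * ring_of e r3)%R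
  | LRingEq r1 r2 => ring_of e r1 = ring_of e r2
  | LCardEq k1 k2 => card_of e k1 = card_of e k2
  | LOrdEq a1 a2 => ord_of e a1 = ord_of e a2
  | LPred P al rl => pred_of e P (map (ord_of e) al) (map (ring_of e) rl)
  | LNot phi => ~ l2_sat e phi
  | LAnd phi psi => l2_sat e phi /\ l2_sat e psi
  | LOr phi psi => l2_sat e phi \/ l2_sat e psi
  | LImp phi psi => l2_sat e phi -> l2_sat e psi
  | LAllRing phi => forall r, l2_sat (env_ring e r) phi
  | LExRing phi => exists r, l2_sat (env_ring e r) phi
  | LAllCard phi => forall k, is_cardinal k -> l2_sat (env_card e k) phi
  | LExCard phi => exists2 k, is_cardinal k & l2_sat (env_card e k) phi
  | LAllOrd k phi =>
      forall a, zin a (card_of e k) -> l2_sat (env_ord e a) phi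
  | LExOrd k phi =>
      exists2 a, zin a (card_of e k) & l2_sat (env_ord e a) phi
  | LAllPred kl n phi =>
      forall P, is_relation (map (card_of e) kl) n P ->
        l2_sat (env_pred e P) phi
  | LExPred kl n phi =>
      exists2 P, is_relation (map (card_of e) kl) n P &
        l2_sat (env_pred e P) phi
  end.

End Semantics.

Definition l2_equivalent (R S : pzRingType) : Prop :=
  forall phi : l2_form, l2_sentence phi ->
    (l2_sat (l2_env0 R) phi <-> l2_sat (l2_env0 S) phi).

(* Main.v *)
(* Every set is in bijection with a cardinal, so a module is coded up to
   isomorphism by a cardinal k together with the graphs of its addition (a
   subset of k^3) and of its scaling (a subset of k^2 x ring), and a linear map
   is coded by its graph; being the code of a module or of a linear map is
   expressible in L_2.  Codes determine modules only up to isomorphism, whereas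
   the language of categories has equality of objects.  Therefore a quantifier
   over modules is translated by treating separately the case of a module equal
   to an earlier one, which re-uses its code, and the case of a new module, which
   gets a fresh code.  Equality of objects then becomes a syntactic matter, and
   the second case loses nothing because every code is the code of a module
   distinct from any given finitely many ones. *)

From HB Require Import structures.
From mathcomp Require Import all_boot all_order all_algebra.
From mathcomp Require Import boolp wochoice.
Require Import Defs.

Set Implicit Arguments.
Unset Strict Implicit.
Unset Printing Implicit Defensive.

Import GRing.Theory.

(** * Sets and cardinals *)

Lemma zset_of_eq u v : zset_of u = zset_of v <-> psim u v.
Proof.
split=> [|uv]; first by move=> /(congr1 sval) /= ->; exact: psim_refl.
apply: eq_exist; apply/funext => w; apply/propext; split=> [uw|vw].
  exact: psim_trans (psim_sym uv) uw.
exact: psim_trans uv vw.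
Qed.

Lemma zset_ofP (x : zset) : exists u, x = zset_of u.
Proof. by case: x => C [u Cu]; exists u; apply: eq_exist. Qed.

Lemma pmem_sim u u' v v' : psim u u' -> psim v v' -> pmem u v -> pmem u' v'.
Proof.
case: v v' => A f [B g] uu' [fg _] [a ua]; have [b ab] := fg a.
by exists b; apply: psim_trans (psim_sym uu') (psim_trans ua ab).
Qed.

Lemma zin_of u v : zin (zset_of u) (zset_of v) <-> pmem u v.
Proof.
split=> [[u' [v' [/zset_of_eq uu' /zset_of_eq vv' uv]]]|uv]; last by exists u, v.
by apply: pmem_sim uv; apply: psim_sym.
Qed.

Lemma zin_wf : well_founded zin.
Proof.
move=> x; have [u ->] := zset_ofP x; elim: u x => A f IH _.
constructor=> y; have [v ->] := zset_ofP y.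
by move=> /zin_of [a /zset_of_eq ->]; exact: IH.
Qed.

Lemma zin_irr x : ~ zin x x.
Proof. by elim/(well_founded_ind zin_wf): x => x IH xx; exact: (IH x). Qed.

Lemma zin_asym x y : zin x y -> ~ zin y x.
Proof.
elim/(well_founded_ind zin_wf): x y => x IH y xy yx; exact: (IH y yx x yx xy).
Qed.

Lemma zin_acyclic3 x y z : zin x y -> zin y z -> ~ zin z x.
Proof.
elim/(well_founded_ind zin_wf): x y z => x IH y z xy yz zx.
exact: (IH z zx x y zx xy yz).
Qed.

(** Replacement for a family indexed by a small type. A representative of each [F a] is chosen by
    [cid]; membership is invariant under [psim], so the choice is immaterial. *)
Definition zrange (A : Type) (F : A -> zset) : zset :=
  zset_of (PSet (fun a => sval (cid (zset_ofP (F a))))).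

Lemma zin_range (A : Type) (F : A -> zset) y :
  zin y (zrange F) <-> exists a, y = F a.
Proof.
have [v ->] := zset_ofP y; rewrite zin_of /=; split=> -[a].
  by case: cid => u /= eq_u /zset_of_eq ->; exists a.
by move=> eq_v; exists a; case: cid => u /= eq_u; apply/zset_of_eq; rewrite eq_v.
Qed.

Lemma zrangeP (x : zset) : exists (A : Type) (F : A -> zset), x = zrange F.
Proof.
have [[A f] ->] := zset_ofP x; exists A, (zset_of \o f); apply/zset_of_eq.
split=> a; exists a; case: cid => u /= /zset_of_eq //.
Qed.

(** * Coding sets by cardinals *)

(** The codes are plain sets rather than members of [elt k], because the predicates of $L_2$ take
    lists of sets as arguments. *)
Definition encodes (x : zset) (g : elt x -> zset) (k : zset) : Prop :=
  injective g /\ forall a, zin a k <-> exists y, a = g y.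

Lemma elt_eq x (y z : elt x) : sval y = sval z -> y = z.
Proof. by case: y z => [y ?] [z ?] /= yz; apply: eq_exist. Qed.

Lemma wellorder_wf (T : eqType) (le : rel T) :
  well_order le -> well_founded (fun x y => ~~ le y x).
Proof.
move=> wo x; apply: contrapT => Nx.
have [|z [[/asboolP Nz zmin] _]] := wo [pred y | `[<~ Acc (fun x y => ~~ le y x) y>]].
  by exists x; apply/asboolP.
apply: Nz; constructor=> y Nle_zy; apply: contrapT => Ny.
by case/negP: Nle_zy; apply: zmin; apply/asboolP.
Qed.

Lemma wellorder_total (T : eqType) (le : rel T) x y :
  well_order le -> [\/ ~~ le y x, x = y | ~~ le x y].
Proof.
move=> wo; case le_xy: (le x y); last by apply: Or33.
case le_yx: (le y x); last by apply: Or31.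
have refl z : le z z.
  have [|w [[/eqP wz wmin] _]] := wo (pred1 z); first by exists z; rewrite inE.
  by rewrite -{1}wz; apply: wmin; rewrite inE.
(* When [le] holds both ways, [x] and [y] are both least in the pair, and uniqueness of the least
   element identifies them. *)
have [|z [_ zmin]] := wo (pred2 x y); first by exists x; rewrite inE eqxx.
apply: Or32; transitivity z; [symmetry|]; apply: zmin; split;
  rewrite ?inE ?eqxx ?orbT //;
  by move=> w /pred2P[]->.
Qed.

(** A well-ordering is collapsed onto an ordinal. What is well ordered is a type [T] of indices, one
    for each element of the set: [elt] of a set lives in the universe of [zset], too large to index
    a [zrange]. *)
Lemma encodes_ordinal (x : zset) : exists g k, is_ordinal k /\ @encodes x g k.
Proof.
have [A [F ->]] := zrangeP x.
have /choice [r rP] (y : elt (zrange F)) : exists a, sval y = F a.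
  exact/zin_range/(svalP y).
pose T := {a : A | exists y, r y = a}.
pose rT (y : elt (zrange F)) : T := exist _ (r y) (ex_intro _ y erefl).
have rT_inj : injective rT.
  by move=> y z /(congr1 sval) /= ryz; apply: elt_eq; rewrite !rP ryz.
have rT_surj (t : T) : exists y, t = rT y.
  by case: t => a [y ra]; exists y; apply: eq_exist.
have [le wo] := well_ordering_principle {classic T}.
pose lt (s t : T) : Prop := ~~ le t s.
have lt_wf : well_founded lt := wellorder_wf wo.
(* The collapse sends [t] to the set of the values at all smaller [s]. *)
pose c : T -> zset := Fix lt_wf (fun=> zset)
  (fun t c => zrange (fun s : {s | lt s t} => c (sval s) (svalP s))).
have cE t : c t = zrange (fun s : {s | lt s t} => c (sval s)).
  rewrite /c Fix_eq // => u f g fg; congr zrange; apply/funext => s; exact: fg.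
have cP t z : zin z (c t) <-> exists2 s, lt s t & z = c s.
  rewrite cE zin_range; split=> [[[s st] ->]|[s st ->]]; first by exists s.
  by exists (exist _ s st).
have lt_total s t : [\/ lt s t, s = t | lt t s] := @wellorder_total {classic T} le s t wo.
have c_inj : injective c.
  move=> s t cst; case: (lt_total s t) => // lt_st; case: (@zin_irr (c s)).
    by rewrite {2}cst; apply/cP; exists s.
  by rewrite {1}cst; apply/cP; exists t.
exists (c \o rT), (zrange c); split; last first.
  split=> [|a]; first exact: inj_comp.
  by rewrite zin_range; split=> [[t ->]|[y ->]]; [have [y ->] := rT_surj t; exists y|exists (rT y)].
split=> [y z /zin_range[t ->] /cP[s _ ->]|y z]; first by apply/zin_range; exists s.
move=> /zin_range[s ->] /zin_range[t ->].
case: (lt_total s t) => st; [apply: Or31|apply: Or32|apply: Or33].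
- by apply/cP; exists s.
- by rewrite st.
- by apply/cP; exists t.
Qed.

Lemma ordinal_elt x y : is_ordinal x -> zin y x -> is_ordinal y.
Proof.
move=> [xtr xtot] yx; split=> [u v uy vu|u v uy vy].
  have ux := xtr _ _ yx uy; have vx := xtr _ _ ux vu.
  (* The two alternatives to [v] being in [y] create membership cycles of length two and three. *)
  case: (xtot _ _ vx yx) => // [vy|yv].
    by case: (@zin_asym u v) => //; rewrite vy.
  by case: (@zin_acyclic3 y v u).
by apply: xtot; apply: xtr yx _.
Qed.

(** Descent on the coding ordinal: as long as it is equinumerous to one of its elements, the codes
    are moved into that element, which is again an ordinal. *)
Lemma encodes_cardinal (x : zset) : exists g k, is_cardinal k /\ @encodes x g k.
Proof.
have [g [k [ok gk]]] := encodes_ordinal x.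
elim/(well_founded_ind zin_wf): k => k IH in g ok gk *.
have [[y yk [h [h' hK h'K]]]|min_k] :=
    pselect (exists2 y, zin y k & equinumerous y k); last first.
  by exists g, k; split=> //; split=> // y yk eq_yk; apply: min_k; exists y.
have g_k z : zin (g z) k by apply/gk.2; exists z.
apply: (IH y yk (fun z => sval (h' (exist _ (g z) (g_k z))))).
  exact: ordinal_elt ok yk.
split=> [u v /elt_eq /(can_inj h'K) /(congr1 sval) /= /gk.1 //|a].
split=> [ay|[z ->]]; last exact: (svalP (h' _)).
have /gk.2[z gz] := svalP (h (exist _ a ay)); exists z.
have -> : exist _ (g z) (g_k z) = h (exist _ a ay) by apply: elt_eq.
by rewrite hK.
Qed.

Definition zpair (y z : zset) : zset := zrange (fun b : bool => if b then y else z).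

Lemma zin_pair y z w : zin w (zpair y z) <-> w = y \/ w = z.
Proof.
rewrite zin_range; split=> [[[] ->]|[]->]; [by left|by right|by exists true|by exists false].
Qed.

Lemma zpair_inj z : injective (zpair^~ z).
Proof.
move=> y y' eq_yy'.
have /zin_pair[//|yz] : zin y (zpair y' z) by rewrite -eq_yy'; apply/zin_pair; left.
have /zin_pair[//|y'z] : zin y' (zpair y z) by rewrite eq_yy'; apply/zin_pair; left.
by rewrite yz y'z.
Qed.

(* The copy consists of the pairs [zpair y t] for [y] in [k], where [t] lies
   in no element of any [L i]. *)
Lemma encodes_fresh (L : nat -> zset) (k y : zset) : zin y k ->
  exists x g, @encodes x g k /\ forall i, x <> L i.
Proof.
pose t := zrange L => yk; have [A [F kE]] := zrangeP k.
pose x := zrange (fun a => zpair (F a) t).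
have /choice [g gP] (z : elt x) : exists u, zin u k /\ sval z = zpair u t.
  have /zin_range [a ->] := svalP z; exists (F a); split=> //.
  by rewrite kE; apply/zin_range; exists a.
have x_in u : zin u k -> zin (zpair u t) x.
  by rewrite kE => /zin_range[a ->]; apply/zin_range; exists a.
exists x, g; split; first split.
- by move=> u v guv; apply: elt_eq; rewrite !(gP _).2 guv.
- move=> a; split=> [ak|[z ->]]; last exact: (gP z).1.
  exists (exist (zin^~ x) _ (x_in a ak)); apply: (@zpair_inj t).
  by rewrite -(gP _).2.
(* If [x] were [L i], then [t], [zpair y t], [x] would form a membership cycle, since [L i] is an
   element of [t]. *)
- move=> i xL; apply: (@zin_acyclic3 t (zpair y t) x); last 1 first.
  + by apply/zin_range; exists i.
  + by apply/zin_pair; right.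
  + exact: x_in.
Qed.

(** * Codes of modules and of linear maps *)

(** The module laws are written relationally, with a variable for each intermediate value and all
    quantifiers bounded, so that each field is literally the meaning of one $L_2$ formula. $L_2$ has
    no constants: the unit of the ring is described as a left identity. *)
Record module_graph (R : pzRingType) (k : zset) (A S : relation_value R) : Prop := {
  graph_add_total : forall x, zin x k -> forall y, zin y k ->
    exists2 z, zin z k & A [:: x; y; z] [::];
  graph_add_fun : forall x, zin x k -> forall y, zin y k ->
    forall z, zin z k -> forall z', zin z' k ->
    A [:: x; y; z] [::] -> A [:: x; y; z'] [::] -> z = z';
  graph_addC : forall x, zin x k -> forall y, zin y k -> forall z, zin z k ->
    A [:: x; y; z] [::] -> A [:: y; x; z] [::];
  graph_addA : forall x, zin x k -> forall y, zin y k -> forall z, zin z k ->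
    forall xy, zin xy k -> forall xyz, zin xyz k -> forall yz, zin yz k ->
    A [:: x; y; xy] [::] -> A [:: xy; z; xyz] [::] -> A [:: y; z; yz] [::] ->
    A [:: x; yz; xyz] [::];
  graph_zero_opp : exists2 o, zin o k & forall x, zin x k ->
    A [:: o; x; x] [::] /\ exists2 y, zin y k & A [:: y; x; o] [::];
  graph_scale_total : forall r x, zin x k ->
    exists2 y, zin y k & S [:: x; y] [:: r];
  graph_scale_fun : forall r x, zin x k -> forall y, zin y k ->
    forall y', zin y' k -> S [:: x; y] [:: r] -> S [:: x; y'] [:: r] -> y = y';
  graph_scaleA : forall r s t, t = (r * s)%R ->
    forall x, zin x k -> forall y, zin y k -> forall z, zin z k ->
    S [:: x; y] [:: s] -> S [:: y; z] [:: r] -> S [:: x; z] [:: t];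
  graph_scale1 : forall u, (forall r, r = (u * r)%R) ->
    forall x, zin x k -> S [:: x; x] [:: u];
  graph_scaleDr : forall r x, zin x k -> forall y, zin y k ->
    forall z, zin z k -> forall x', zin x' k -> forall y', zin y' k ->
    forall z', zin z' k -> A [:: x; y; z] [::] -> S [:: x; x'] [:: r] ->
    S [:: y; y'] [:: r] -> S [:: z; z'] [:: r] -> A [:: x'; y'; z'] [::];
  graph_scaleDl : forall r s t, t = (r + s)%R -> forall x, zin x k ->
    forall y, zin y k -> forall z, zin z k -> forall w, zin w k ->
    S [:: x; y] [:: r] -> S [:: x; z] [:: s] -> S [:: x; w] [:: t] ->
    A [:: y; z; w] [::]
}.

Definition LAllOrds (k n : nat) : l2_form -> l2_form := iter n (LAllOrd k).

(** The order is that of the fields of [module_graph]. Each axiom is read with no ring or ordinal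
    variable in scope, so in both sorts the numbering starts at 0 with the outermost quantifier. *)
Definition module_axioms (k p q : nat) : seq l2_form :=
  let A x y z := LPred p [:: x; y; z] [::] in
  let S r x y := LPred q [:: x; y] [:: r] in
  [:: LAllOrds k 2 (LExOrd k (A 0 1 2));
      LAllOrds k 4 (LImp (A 0 1 2) (LImp (A 0 1 3) (LOrdEq 2 3)));
      LAllOrds k 3 (LImp (A 0 1 2) (A 1 0 2));
      LAllOrds k 6
        (LImp (A 0 1 3) (LImp (A 3 2 4) (LImp (A 1 2 5) (A 0 5 4))));
      LExOrd k (LAllOrd k (LAnd (A 0 1 1) (LExOrd k (A 2 1 0))));
      LAllRing (LAllOrd k (LExOrd k (S 0 0 1)));
      LAllRing (LAllOrds k 3 (LImp (S 0 0 1) (LImp (S 0 0 2) (LOrdEq 1 2))));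
      LAllRing (LAllRing (LAllRing (LImp (LRingMul 2 0 1)
        (LAllOrds k 3 (LImp (S 1 0 1) (LImp (S 0 1 2) (S 2 0 2)))))));
      LAllRing (LImp (LAllRing (LRingMul 1 0 1)) (LAllOrd k (S 0 0 0)));
      LAllRing (LAllOrds k 6 (LImp (A 0 1 2)
        (LImp (S 0 0 3) (LImp (S 0 1 4) (LImp (S 0 2 5) (A 3 4 5))))));
      LAllRing (LAllRing (LAllRing (LImp (LRingAdd 2 0 1)
        (LAllOrds k 4 (LImp (S 0 0 1) (LImp (S 1 0 2) (LImp (S 2 0 3)
          (A 1 2 3))))))))].

Definition LTrue : l2_form := LAllRing (LRingEq 0 0).

Definition LAnds : seq l2_form -> l2_form := foldr LAnd LTrue.

Definition module_form (k p q : nat) : l2_form := LAnds (module_axioms k p q).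

(** Once the ring and ordinal environments are empty, the lookups of bound variables compute, and
    the two sides agree by conversion, field by field. *)
Lemma module_formP (R : pzRingType) (e : l2_env R) (k p q : nat) :
  ering e = [::] -> eord e = [::] ->
  l2_sat e (module_form k p q) <->
    module_graph (card_of e k) (pred_of e p) (pred_of e q).
Proof.
case: e => rs K os Q /= -> ->.
split=> [[? [? [? [? [? [? [? [? [? [? [? _]]]]]]]]]]]|]; first by split.
case=> a1 a2 a3 a4 a5 s1 s2 s3 s4 s5 s6.
exact: (conj a1 (conj a2 (conj a3 (conj a4 (conj a5 (conj s1 (conj s2
  (conj s3 (conj s4 (conj s5 (conj s6 (fun=> erefl)))))))))))).
Qed.

Lemma module_form_wf (c : l2_ctx) (k p q : nat) :
  cring c = 0 -> cord c = [::] -> k < ccard c ->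
  p < size (cpred c) -> nth ([::], 0) (cpred c) p = ([:: k; k; k], 0) ->
  q < size (cpred c) -> nth ([::], 0) (cpred c) q = ([:: k; k], 1) ->
  l2_wf c (module_form k p q).
Proof.
case: c => rs cs os ps /= -> -> kc pc pE qc qE.
by rewrite kc pc qc pE qE /= !eqxx.
Qed.

Record coded (R : pzRingType) : Type := Coded {
  cmod : module R;
  cenc : elt (mod_set cmod) -> zset
}.

Arguments cenc {R} c _.

(** [A] and [S] are constrained only at codes of elements, which is where the bounded quantifiers of
    the formulas evaluate them. *)
Definition represents (R : pzRingType) (C : coded R) (k : zset)
    (A S : relation_value R) : Prop :=
  [/\ encodes (cenc C) k,
      forall x y z : mod_sort (cmod C),
        A [:: cenc C x; cenc C y; cenc C z] [::] <-> (x + y = z)%R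
    & forall r (x y : mod_sort (cmod C)),
        S [:: cenc C x; cenc C y] [:: r] <-> (r *: x = y)%R].

Lemma represents_graph (R : pzRingType) (C : coded R) k A S :
  represents C k A S -> module_graph k A S.
Proof.
move=> [[inj_c ck] AP SP].
have c_in x : zin (cenc C x) k by apply/ck; exists x.
split.
- move=> _ /ck[x ->] _ /ck[y ->].
  by exists (cenc C ((x : mod_sort _) + y)%R); rewrite ?AP.
- by move=> _ /ck[x ->] _ /ck[y ->] _ /ck[z ->] _ /ck[z' ->] /AP <- /AP <-.
- by move=> _ /ck[x ->] _ /ck[y ->] _ /ck[z ->] /AP <-; apply/AP; rewrite addrC.
- move=> _ /ck[x ->] _ /ck[y ->] _ /ck[z ->] _ /ck[u ->] _ /ck[v ->] _ /ck[w ->].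
  by move=> /AP <- /AP <- /AP <-; apply/AP; rewrite addrA.
- exists (cenc C (0%R : mod_sort (cmod C))) => // _ /ck[x ->].
  split; first by apply/AP; rewrite add0r.
  by exists (cenc C (- (x : mod_sort _))%R) => //; apply/AP; rewrite addNr.
- move=> r _ /ck[x ->].
  by exists (cenc C (r *: (x : mod_sort _))%R); rewrite ?SP.
- by move=> r _ /ck[x ->] _ /ck[y ->] _ /ck[y' ->] /SP <- /SP <-.
- move=> r s t -> _ /ck[x ->] _ /ck[y ->] _ /ck[z ->] /SP <- /SP <-.
  by apply/SP; rewrite scalerA.
- move=> u u1 _ /ck[x ->]; apply/SP.
  (* Taking [r] to be 1 in the hypothesis on [u] gives [u = 1]. *)
  by rewrite -[u]mulr1 -u1 scale1r.
- move=> r _ /ck[x ->] _ /ck[y ->] _ /ck[z ->] _ /ck[x' ->] _ /ck[y' ->] _ /ck[z' ->].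
  by move=> /AP <- /SP <- /SP <- /SP <-; apply/AP; rewrite scalerDr.
- move=> r s t -> _ /ck[x ->] _ /ck[y ->] _ /ck[z ->] _ /ck[w ->].
  by move=> /SP <- /SP <- /SP <-; apply/AP; rewrite scalerDl.
Qed.

(** The coded module is [M] itself and not merely an isomorphic copy, as is required to instantiate
    a quantifier over modules at [M]. *)
Lemma module_represented (R : pzRingType) (M : module R) :
  exists C k A S, [/\ cmod C = M, is_cardinal k, is_relation [:: k; k; k] 0 A,
    is_relation [:: k; k] 1 S & @represents R C k A S].
Proof.
have [g [k [card_k gk]]] := encodes_cardinal (mod_set M).
have g_k x : zin (g x) k by apply/gk.2; exists x.
exists (Coded g), k.
exists (fun al rl => exists x y : mod_sort M, al = [:: g x; g y; g (x + y)%R] /\ rl = [::]).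
exists (fun al rl => exists r (x : mod_sort M), al = [:: g x; g (r *: x)%R] /\ rl = [:: r]).
split=> //.
- by move=> _ _ [x [y [-> ->]]]; split=> // -[|[|[|i]]] //= _; exact: g_k.
- by move=> _ _ [r [x [-> ->]]]; split=> // -[|[|i]] //= _; exact: g_k.
split=> // [x y z|r x y] /=; split.
- by case=> u [v [[/gk.1 -> /gk.1 -> /gk.1 ->] _]].
- by move=> <-; exists x, y.
- by case=> s [u [[/gk.1 -> /gk.1 ->] [->]]].
- by move=> <-; exists r, x.
Qed.

(** The operations read off from the graphs are transported to a set in bijection with [k] that
    differs from every carrier in the list; distinct carriers make distinct modules. *)
Lemma graph_represented (R : pzRingType) k A S (L : nat -> module R) :
  module_graph k A S ->
  exists C, represents C k A S /\ forall i, cmod C <> L i.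
Proof.
(* The zero of the coded module is the element of [k] that [encodes_fresh] asks for. *)
move=> G; have [o ok _] := graph_zero_opp G.
have [x [g [[g_inj gk] fresh]]] := encodes_fresh (fun i => mod_set (L i)) ok.
have g_in u : zin (g u) k by apply/gk; exists u.
have /choice [add addE] (uv : elt x * elt x) :
    exists w, A [:: g uv.1; g uv.2; g w] [::].
  have [w /gk[w' ->]] := graph_add_total G (g_in uv.1) (g_in uv.2).
  by exists w'.
have addP u v w : A [:: g u; g v; g w] [::] <-> add (u, v) = w.
  split=> [uvw|<-]; last exact: (addE (u, v)).
  exact/g_inj/(graph_add_fun G _ _ _ _ (addE (u, v)) uvw).
have /choice [scl sclE] (ru : R * elt x) : exists w, S [:: g ru.2; g w] [:: ru.1].
  have [w /gk[w' ->]] := graph_scale_total G ru.1 (g_in ru.2).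
  by exists w'.
have sclP r u v : S [:: g u; g v] [:: r] <-> scl (r, u) = v.
  split=> [uv|<-]; last exact: (sclE (r, u)).
  exact/g_inj/(graph_scale_fun G _ _ _ (sclE (r, u)) uv).
have [_ /gk[zero ->] zeroP] := graph_zero_opp G.
have /choice [opp oppP] u : exists v, A [:: g v; g u; g zero] [::].
  by have [_ [_ /gk[v ->]]] := zeroP _ (g_in u); exists v.
have addA : associative (fun u v => add (u, v)).
  move=> u v w; apply/addP.
  by apply: (graph_addA G) (addE (u, v)) (addE (_, _)) (addE (_, _)).
have addC : commutative (fun u v => add (u, v)).
  by move=> u v; apply/addP; apply: (graph_addC G) (addE (v, u)).
have add0 : left_id zero (fun u v => add (u, v)).
  by move=> u; apply/addP; case: (zeroP _ (g_in u)).
have addN : left_inverse zero opp (fun u v => add (u, v)).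
  by move=> u; apply/addP; apply: oppP.
have sclA r s u : scl (r, scl (s, u)) = scl ((r * s)%R, u).
  by apply/esym/sclP; apply: (graph_scaleA G) (sclE (s, u)) (sclE (r, _)).
have scl1 : left_id 1%R (fun r u => scl (r, u)).
  by move=> u; apply/sclP; apply: (graph_scale1 G) => // r; rewrite mul1r.
have sclDr : right_distributive (fun r u => scl (r, u)) (fun u v => add (u, v)).
  move=> r u v; apply/esym/addP.
  by apply: (graph_scaleDr G) (addE (u, v)) (sclE (r, u)) (sclE (r, v)) (sclE (r, _)).
have sclDl u r s : scl ((r + s)%R, u) = add (scl (r, u), scl (s, u)).
  apply/esym/addP.
  by apply: (graph_scaleDl G) (sclE (r, u)) (sclE (s, u)) (sclE ((r + s)%R, u)).
exists (@Coded R (Module addA addC add0 addN sclA scl1 sclDr sclDl) g).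
split=> [|i /(congr1 (@mod_set R))]; first by split.
exact: fresh.
Qed.

(** * Codes of linear maps *)

Record hom_graph (R : pzRingType) (k l : zset) (A S B T P : relation_value R) :
    Prop := {
  graph_total : forall x, zin x k -> exists2 y, zin y l & P [:: x; y] [::];
  graph_fun : forall x, zin x k -> forall y, zin y l -> forall y', zin y' l ->
    P [:: x; y] [::] -> P [:: x; y'] [::] -> y = y';
  graph_homD : forall x, zin x k -> forall y, zin y k -> forall z, zin z k ->
    forall x', zin x' l -> forall y', zin y' l -> forall z', zin z' l ->
    A [:: x; y; z] [::] -> P [:: x; x'] [::] -> P [:: y; y'] [::] ->
    P [:: z; z'] [::] -> B [:: x'; y'; z'] [::];
  graph_homZ : forall r x, zin x k -> forall y, zin y k ->
    forall x', zin x' l -> forall y', zin y' l -> S [:: x; y] [:: r] ->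
    P [:: x; x'] [::] -> P [:: y; y'] [::] -> T [:: x'; y'] [:: r]
}.

(** Elements of the domain are quantified before those of the codomain, so their images get the
    later numbers: 3, 4, 5 for additivity and 2, 3 for scaling. *)
Definition hom_form (k l a s b t p : nat) : l2_form :=
  let P x y := LPred p [:: x; y] [::] in
  LAnds [::
    LAllOrd k (LExOrd l (P 0 1));
    LAllOrd k (LAllOrds l 2 (LImp (P 0 1) (LImp (P 0 2) (LOrdEq 1 2))));
    LAllOrds k 3 (LAllOrds l 3 (LImp (LPred a [:: 0; 1; 2] [::])
      (LImp (P 0 3) (LImp (P 1 4) (LImp (P 2 5)
        (LPred b [:: 3; 4; 5] [::]))))));
    LAllRing (LAllOrds k 2 (LAllOrds l 2 (LImp (LPred s [:: 0; 1] [:: 0])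
      (LImp (P 0 2) (LImp (P 1 3) (LPred t [:: 2; 3] [:: 0]))))))].

Lemma hom_formP (R : pzRingType) (e : l2_env R) (k l a s b t p : nat) :
  ering e = [::] -> eord e = [::] ->
  l2_sat e (hom_form k l a s b t p) <->
    hom_graph (card_of e k) (card_of e l) (pred_of e a) (pred_of e s)
      (pred_of e b) (pred_of e t) (pred_of e p).
Proof.
case: e => rs K os Q /= -> ->.
split=> [[? [? [? [? _]]]]|]; first by split.
case=> total func homD homZ.
exact: (conj total (conj func (conj homD (conj homZ (fun=> erefl))))).
Qed.

Lemma hom_form_wf (c : l2_ctx) (k l a s b t p : nat) :
  cring c = 0 -> cord c = [::] -> k < ccard c -> l < ccard c ->
  a < size (cpred c) -> nth ([::], 0) (cpred c) a = ([:: k; k; k], 0) ->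
  s < size (cpred c) -> nth ([::], 0) (cpred c) s = ([:: k; k], 1) ->
  b < size (cpred c) -> nth ([::], 0) (cpred c) b = ([:: l; l; l], 0) ->
  t < size (cpred c) -> nth ([::], 0) (cpred c) t = ([:: l; l], 1) ->
  p < size (cpred c) -> nth ([::], 0) (cpred c) p = ([:: k; l], 0) ->
  l2_wf c (hom_form k l a s b t p).
Proof.
case: c => rs cs os ps /= -> -> kc lc ac aE sc sE bc bE tc tE pc pE.
by rewrite kc lc ac aE sc sE bc bE tc tE pc pE /= !eqxx.
Qed.

Definition hom_represents (R : pzRingType) (C D : coded R)
    (P : relation_value R) (h : mod_hom (cmod C) (cmod D)) : Prop :=
  forall x y, P [:: cenc C x; cenc D y] [::] <-> h x = y.

Lemma hom_represents_graph (R : pzRingType) (C D : coded R) k l A S B T P h :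
  represents C k A S -> represents D l B T -> @hom_represents R C D P h ->
  hom_graph k l A S B T P.
Proof.
move=> [[_ ck] AP SP] [[_ dl] BP TP] hP.
split.
- by move=> _ /ck[x ->]; exists (cenc D (h x)); [apply/dl; exists (h x)|apply/hP].
- by move=> _ /ck[x ->] _ /dl[y ->] _ /dl[y' ->] /hP <- /hP <-.
- move=> _ /ck[x ->] _ /ck[y ->] _ /ck[z ->] _ /dl[x' ->] _ /dl[y' ->] _ /dl[z' ->].
  by move=> /AP <- /hP <- /hP <- /hP <-; apply/BP; rewrite linearD.
- move=> r _ /ck[x ->] _ /ck[y ->] _ /dl[x' ->] _ /dl[y' ->].
  by move=> /SP <- /hP <- /hP <-; apply/TP; rewrite linearZ.
Qed.

Lemma hom_represented (R : pzRingType) (C D : coded R) k l A S B T h :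
  represents C k A S -> represents D l B T ->
  exists2 P, is_relation [:: k; l] 0 P & @hom_represents R C D P h.
Proof.
move=> [[c_inj ck] _ _] [[d_inj dl] _ _].
exists (fun al rl => exists x, al = [:: cenc C x; cenc D (h x)] /\ rl = [::]).
  move=> _ _ [x [-> ->]]; split=> // -[|[|]] //= _; first by apply/ck; exists x.
  by apply/dl; exists (h x).
by move=> x y; split=> [[x' [[/c_inj -> /d_inj ->] _]]|<-]; last by exists x.
Qed.

Lemma graph_hom_represented (R : pzRingType) (C D : coded R) k l A S B T P :
  represents C k A S -> represents D l B T -> hom_graph k l A S B T P ->
  exists h, @hom_represents R C D P h.
Proof.
move=> [[c_inj ck] AP SP] [[d_inj dl] BP TP] G.
have c_in x : zin (cenc C x) k by apply/ck; exists x.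
have d_in x : zin (cenc D x) l by apply/dl; exists x.
have /choice [f fE] (x : mod_sort (cmod C)) :
    exists y : mod_sort (cmod D), P [:: cenc C x; cenc D y] [::].
  by have [_ /dl[y ->]] := graph_total G (c_in x); exists y.
have fD : forall x y, f (x + y)%R = (f x + f y)%R.
  move=> x y; apply/esym/BP.
  by apply: (graph_homD G) (fE x) (fE y) (fE _) => //; apply/AP.
have fZ : forall r x, f (r *: x)%R = (r *: f x)%R.
  move=> r x; apply/esym/TP.
  by apply: (graph_homZ G) (fE x) (fE _) => //; apply/SP.
have f_lin : linear f by move=> r x y; rewrite fD fZ.
pose h : mod_hom (cmod C) (cmod D) :=
  HB.pack f (GRing.isLinear.Build R (mod_sort (cmod C)) (mod_sort (cmod D)) *:%R f f_lin).
exists h => x y; split=> [xy|<-]; last exact: fE.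
by apply/d_inj/(graph_fun G _ _ _ (fE x) xy).
Qed.

(** * The translation *)

Record arrow_slot : Type := ArrowSlot { adom : nat; acod : nat; apred : nat }.

(* The module in slot [s] is carried by the cardinal variable number [s];
   [ladd s] and [lscl s] number the predicate variables for the graphs of its
   addition and of its scaling.  Object variables are mapped to slots, arrow
   variables to an [arrow_slot]. *)
Record layout : Type := Layout {
  nmod : nat;
  lpreds : seq (seq nat * nat);
  ladd : nat -> nat;
  lscl : nat -> nat
}.

(** Ring and ordinal variables are bound only inside the formulas for codes and for atoms, so none
    is in scope where a subformula is translated. *)
Definition layout_ctx (L : layout) : l2_ctx :=
  L2Ctx 0 (nmod L) [::] (lpreds L).

Definition pred_declared (L : layout) (p : nat) (d : seq nat * nat) : Prop :=
  p < size (lpreds L) /\ nth ([::], 0) (lpreds L) p = d.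

Definition layout_ok (L : layout) : Prop := forall s, s < nmod L ->
  pred_declared L (ladd L s) ([:: s; s; s], 0) /\
  pred_declared L (lscl L s) ([:: s; s], 1).

Definition arrow_slot_ok (L : layout) (t : arrow_slot) : Prop :=
  [/\ adom t < nmod L, acod t < nmod L
    & pred_declared L (apred t) ([:: adom t; acod t], 0)].

Definition arrow_represented (R : pzRingType) (C D : coded R)
    (P : relation_value R) (f : arrow (modcat R)) : Prop :=
  exists2 h : mod_hom (cmod C) (cmod D),
    f = @Arrow (modcat R) (cmod C) (cmod D) h & hom_represents P h.

Record models (L : layout) (m : nat) (ars : m.-tuple arrow_slot)
    (R : pzRingType) (e : l2_env R) (Cs : nat -> coded R)
    (a : m.-tuple (arrow (modcat R))) : Prop := {
  models_ring : ering e = [::];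
  models_ord : eord e = [::];
  models_card : size (ecard e) = nmod L;
  models_pred : size (epred e) = size (lpreds L);
  models_mod : forall s, s < nmod L ->
    represents (Cs s) (card_of e s) (pred_of e (ladd L s)) (pred_of e (lscl L s));
  (* Hence object variables are equal if and only if their slots are. *)
  models_inj : forall s t, s < nmod L -> t < nmod L ->
    cmod (Cs s) = cmod (Cs t) -> s = t;
  models_arr : forall j, let t := tnth ars j in
    arrow_represented (Cs (adom t)) (Cs (acod t)) (pred_of e (apred t)) (tnth a j)
}.

Definition mod_pred (m : nat) : Type :=
  forall R : pzRingType, (nat -> module R) -> m.-tuple (arrow (modcat R)) -> Prop.

(** The formula [psi] is chosen before the ring, so a single formula serves all rings at once; this
    uniformity is what makes two rings comparable. *)
Definition expressible (L : layout) (m : nat) (ars : m.-tuple arrow_slot)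
    (Phi : mod_pred m) : Prop :=
  exists psi, l2_wf (layout_ctx L) psi /\
    forall R e Cs a, @models L m ars R e Cs a ->
      (l2_sat e psi <-> Phi R (fun s => cmod (Cs s)) a).

(** * Closure of expressibility under connectives *)

Section Expressible.
Context (L : layout) (m : nat) (ars : m.-tuple arrow_slot).
Implicit Types Phi Psi : mod_pred m.

Lemma expressible_ext Phi Psi :
  (forall R Ms a, Phi R Ms a <-> Psi R Ms a) ->
  expressible L ars Phi -> expressible L ars Psi.
Proof.
move=> PhiPsi [psi [wf sat]]; exists psi; split=> // R e Cs a M.
exact: iff_trans (sat R e Cs a M) (PhiPsi _ _ _).
Qed.

(** Serves for comparisons of slots, which are decided during the translation. *)
Lemma expressible_bool (b : bool) : expressible L ars (fun _ _ _ => b).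
Proof.
exists (if b then LTrue else LNot LTrue); split; first by case: b.
move=> R e Cs a _; have t : l2_sat e LTrue by [].
by case: b; split=> //= /(_ t).
Qed.

Lemma expressible_not Phi :
  expressible L ars Phi -> expressible L ars (fun R Ms a => ~ Phi R Ms a).
Proof.
move=> [psi [wf sat]]; exists (LNot psi); split=> // R e Cs a M /=.
by have := sat R e Cs a M; tauto.
Qed.

Lemma expressible_and Phi Psi :
  expressible L ars Phi -> expressible L ars Psi ->
  expressible L ars (fun R Ms a => Phi R Ms a /\ Psi R Ms a).
Proof.
move=> [phi [wf_phi satphi]] [psi [wf_psi satpsi]].
exists (LAnd phi psi); split=> [|R e Cs a M]; first exact/andP.
by have := satphi R e Cs a M; have := satpsi R e Cs a M; rewrite /=; tauto.
Qed.

Lemma expressible_or Phi Psi :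
  expressible L ars Phi -> expressible L ars Psi ->
  expressible L ars (fun R Ms a => Phi R Ms a \/ Psi R Ms a).
Proof.
move=> [phi [wf_phi satphi]] [psi [wf_psi satpsi]].
exists (LOr phi psi); split=> [|R e Cs a M]; first exact/andP.
by have := satphi R e Cs a M; have := satpsi R e Cs a M; rewrite /=; tauto.
Qed.

Lemma expressible_imp Phi Psi :
  expressible L ars Phi -> expressible L ars Psi ->
  expressible L ars (fun R Ms a => Phi R Ms a -> Psi R Ms a).
Proof.
move=> [phi [wf_phi satphi]] [psi [wf_psi satpsi]].
exists (LImp phi psi); split=> [|R e Cs a M]; first exact/andP.
by have := satphi R e Cs a M; have := satpsi R e Cs a M; rewrite /=; tauto.
Qed.

Lemma expressible_forall_lt (n : nat) (Phi : nat -> mod_pred m) :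
  (forall s, s < n -> expressible L ars (Phi s)) ->
  expressible L ars (fun R Ms a => forall s, s < n -> Phi s R Ms a).
Proof.
elim: n => [|n IH] Phi_s.
  by apply: expressible_ext (expressible_bool true) => R Ms a; split.
have exp_lt := IH (fun s sn => Phi_s s (ltnW sn)).
apply: expressible_ext (expressible_and exp_lt (Phi_s n (ltnSn n))) => R Ms a.
split=> [[Phi_lt Phi_n] s|Phi_lt].
  by rewrite ltnS leq_eqVlt => /orP[/eqP->|/Phi_lt].
by split=> [s sn|]; apply: Phi_lt => //; apply: ltnW.
Qed.

End Expressible.

(** * Extending a layout by a module or a linear map *)

Definition upd (T : Type) (f : nat -> T) (n : nat) (v : T) : nat -> T :=
  fun i => if i == n then v else f i.

Lemma upd_eq (T : Type) (f : nat -> T) n v : upd f n v n = v.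
Proof. by rewrite /upd eqxx. Qed.

Lemma upd_lt (T : Type) (f : nat -> T) n v i : i < n -> upd f n v i = f i.
Proof. by rewrite /upd; case: ltngtP. Qed.

Section Environments.
Context (R : pzRingType) (e : l2_env R).

Lemma card_of_old k s : s < size (ecard e) -> card_of (env_card e k) s = card_of e s.
Proof. by move=> s_lt; rewrite /card_of /= nth_rcons s_lt. Qed.

Lemma card_of_new k : card_of (env_card e k) (size (ecard e)) = k.
Proof. by rewrite /card_of /= nth_rcons ltnn eqxx. Qed.

Lemma pred_of_old P p : p < size (epred e) -> pred_of (env_pred e P) p = pred_of e p.
Proof. by move=> p_lt; rewrite /pred_of /= nth_rcons p_lt. Qed.

Lemma pred_of_new P : pred_of (env_pred e P) (size (epred e)) = P.
Proof. by rewrite /pred_of /= nth_rcons ltnn eqxx. Qed.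

End Environments.

Definition add_mod (L : layout) : layout :=
  let N := nmod L in let p := size (lpreds L) in
  Layout N.+1 (rcons (rcons (lpreds L) ([:: N; N; N], 0)) ([:: N; N], 1))
    (upd (ladd L) N p) (upd (lscl L) N p.+1).

Definition add_hom (L : layout) (d c : nat) : layout :=
  Layout (nmod L) (rcons (lpreds L) ([:: d; c], 0)) (ladd L) (lscl L).

Lemma pred_declared_add_mod L p d :
  pred_declared L p d -> pred_declared (add_mod L) p d.
Proof.
case=> p_lt pE; split; first by rewrite /= !size_rcons ltnS leqW // ltnW.
by rewrite /= !nth_rcons size_rcons p_lt ltnS ltnW.
Qed.

Lemma pred_declared_add_hom L d c p q :
  pred_declared L p q -> pred_declared (add_hom L d c) p q.
Proof.
case=> p_lt pE; split; first by rewrite /= size_rcons ltnS ltnW.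
by rewrite /= nth_rcons p_lt.
Qed.

Lemma add_mod_ok L : layout_ok L -> layout_ok (add_mod L).
Proof.
move=> okL s; rewrite /= ltnS leq_eqVlt => /predU1P[->|s_lt]; last first.
  rewrite !upd_lt //; have [? ?] := okL s s_lt.
  by split; apply: pred_declared_add_mod.
rewrite !upd_eq /pred_declared /= !size_rcons !nth_rcons !size_rcons.
by rewrite ltnn eqxx !ltnS leqnn leqnSn ltnn eqxx.
Qed.

Lemma add_mod_arrow_ok L t : arrow_slot_ok L t -> arrow_slot_ok (add_mod L) t.
Proof.
case=> d_lt c_lt dec; split; rewrite /= ?ltnS 1?ltnW //.
exact: pred_declared_add_mod.
Qed.

Lemma add_hom_ok L d c : layout_ok L -> layout_ok (add_hom L d c).
Proof.
by move=> okL s /okL[? ?]; split; apply: pred_declared_add_hom.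
Qed.

Lemma add_hom_arrow_ok L d c t :
  arrow_slot_ok L t -> arrow_slot_ok (add_hom L d c) t.
Proof. by case=> *; split=> //; apply: pred_declared_add_hom. Qed.

Lemma arrow_slot_ok_rcons L m (ars : m.-tuple arrow_slot) t :
  (forall j, arrow_slot_ok L (tnth ars j)) -> arrow_slot_ok L t ->
  forall j, arrow_slot_ok L (tnth [tuple of rcons ars t] j).
Proof.
move=> okars okt j; rewrite (tnth_nth t) /= nth_rcons size_tuple.
case: ltngtP => [j_lt|j_gt|//]; last by move: (ltn_ord j); rewrite ltnS leqNgt j_gt.
by rewrite -[j : nat]/(nat_of_ord (Ordinal j_lt)) -tnth_nth.
Qed.

(** New variables are appended, so old ones keep their numbers and values. That [C] differs from the
    earlier modules preserves [models_inj]. *)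
Lemma models_add_mod L m (ars : m.-tuple arrow_slot) R e Cs a C k A S :
  layout_ok L -> (forall j, arrow_slot_ok L (tnth ars j)) ->
  @models L m ars R e Cs a -> represents C k A S ->
  (forall s, s < nmod L -> cmod C <> cmod (Cs s)) ->
  models (add_mod L) ars (env_pred (env_pred (env_card e k) A) S)
    (upd Cs (nmod L) C) a.
Proof.
move=> okL okars M repC C_new.
have old p : p < size (lpreds L) ->
    pred_of (env_pred (env_pred (env_card e k) A) S) p = pred_of e p.
  move=> p_lt; rewrite !pred_of_old //= ?size_rcons (models_pred M) //.
  exact: ltnW.
split=> [||||s|s t|j].
- exact: models_ring M.
- exact: models_ord M.
- by rewrite /= size_rcons (models_card M).
- by rewrite /= !size_rcons (models_pred M).
- rewrite /= ltnS leq_eqVlt => /predU1P[->|s_lt]; last first.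
    have [[addlt _] [scllt _]] := okL s s_lt.
    rewrite !upd_lt // !old // -[card_of _ s]/(card_of (env_card e k) s).
    by rewrite card_of_old ?(models_card M) //; apply: models_mod M _ _.
  rewrite !upd_eq -(models_card M) -(models_pred M).
  have -> : (size (epred e)).+1 = size (epred (env_pred (env_card e k) A)).
    by rewrite /= size_rcons.
  rewrite pred_of_new pred_of_old /= ?size_rcons //.
  rewrite -[card_of _ _]/(card_of (env_card e k) _) card_of_new.
  by rewrite (pred_of_new (env_card e k)).
- rewrite /= ltnS leq_eqVlt => /predU1P[->|s_lt];
    rewrite ltnS leq_eqVlt => /predU1P[->|t_lt] //.
  + by rewrite upd_eq upd_lt // => /(C_new t t_lt).
  + by rewrite upd_eq upd_lt // => /esym/(C_new s s_lt).
  + by rewrite !upd_lt //; apply: models_inj M _ _ _ _.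
- have [d_lt c_lt [p_lt _]] := okars j.
  by rewrite /= !upd_lt // old //; apply: models_arr M j.
Qed.

Lemma models_add_hom L m (ars : m.-tuple arrow_slot) R e Cs a d c P
    (h : mod_hom (cmod (Cs d)) (cmod (Cs c))) :
  layout_ok L -> (forall j, arrow_slot_ok L (tnth ars j)) ->
  @models L m ars R e Cs a -> hom_represents P h ->
  models (add_hom L d c) [tuple of rcons ars (ArrowSlot d c (size (lpreds L)))]
    (env_pred e P) Cs [tuple of rcons a (@Arrow (modcat R) _ _ h)].
Proof.
move=> okL okars M repP.
have old p : p < size (lpreds L) -> pred_of (env_pred e P) p = pred_of e p.
  by move=> p_lt; rewrite pred_of_old // (models_pred M).
split=> [||||s|s t|j].
- exact: models_ring M.
- exact: models_ord M.
- exact: models_card M.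
- by rewrite /= !size_rcons (models_pred M).
- move=> s_lt; have [[addlt _] [scllt _]] := okL s s_lt.
  by rewrite !old //; apply: models_mod M _ _.
- exact: models_inj M _ _.
- set t := ArrowSlot _ _ _; set f := Arrow _.
  rewrite (tnth_nth t) (tnth_nth f) /= !nth_rcons !size_tuple.
  case: ltngtP => [j_lt|j_gt|_].
  + rewrite -[j : nat]/(nat_of_ord (Ordinal j_lt)) -!tnth_nth.
    have [_ _ [p_lt _]] := okars (Ordinal j_lt).
    by rewrite old //; apply: models_arr M _.
  + by move: (ltn_ord j); rewrite ltnS leqNgt j_gt.
  + by exists h; rewrite //= -(models_pred M) pred_of_new.
Qed.

(** * Quantifiers over modules and linear maps *)

(** The locality hypothesis on [Phi] lets the family of modules be altered at the slot [nmod L],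
    where the new module is stored. *)
Lemma expressible_all_mod L m (ars : m.-tuple arrow_slot)
    (Phi : forall R : pzRingType, module R -> (nat -> module R) ->
      m.-tuple (arrow (modcat R)) -> Prop) :
  layout_ok L -> (forall j, arrow_slot_ok L (tnth ars j)) ->
  (forall R X Ms Ms' a, (forall s, s < nmod L -> Ms s = Ms' s) ->
    Phi R X Ms a -> Phi R X Ms' a) ->
  (forall s, s < nmod L -> expressible L ars (fun R Ms a => Phi R (Ms s) Ms a)) ->
  expressible (add_mod L) ars (fun R Ms a => Phi R (Ms (nmod L)) Ms a) ->
  expressible L ars (fun R Ms a => forall X, Phi R X Ms a).
Proof.
move=> okL okars Phi_local /expressible_forall_lt [phi [wf_phi phiP]] [psi [wf_psi psiP]].
pose N := nmod L; pose p := size (lpreds L).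
(* [phi] is the finite conjunction over the existing slots; the second conjunct speaks of an
   arbitrary code of a new module. *)
exists (LAnd phi (LAllCard (LAllPred [:: N; N; N] 0 (LAllPred [:: N; N] 1
  (LImp (module_form N p p.+1) psi))))); split.
  have [[ap aE] [sp sE]] := add_mod_ok okL (ltnSn N : N < nmod (add_mod L)).
  rewrite /= !upd_eq in ap aE sp sE.
  have wf_mod : l2_wf (layout_ctx (add_mod L)) (module_form N p p.+1).
    by apply: module_form_wf => //=.
  suff: [&& l2_wf (layout_ctx L) phi,
      all (fun k => k < N.+1) [:: N; N; N], all (fun k => k < N.+1) [:: N; N],
      l2_wf (layout_ctx (add_mod L)) (module_form N p p.+1)
    & l2_wf (layout_ctx (add_mod L)) psi] by [].
  by rewrite wf_phi wf_mod wf_psi /= ltnSn.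
move=> R e Cs a M.
have e'N0 k : card_of (env_card e k) N = k by rewrite -[N](models_card M) card_of_new.
have e'N k A S : card_of (env_pred (env_pred (env_card e k) A) S) N = k := e'N0 k.
have e'p k A S : pred_of (env_pred (env_pred (env_card e k) A) S) p = A.
  rewrite -[p](models_pred M) pred_of_old ?size_rcons //.
  exact: (pred_of_new (env_card e k)).
have e'p1 k A S : pred_of (env_pred (env_pred (env_card e k) A) S) p.+1 = S.
  rewrite -[p](models_pred M) -(size_rcons (epred e) A).
  exact: (pred_of_new (env_pred (env_card e k) A)).
split=> [[sat_phi sat_psi] X|all_Phi].
- have [[s s_lt <-]|X_new] := pselect (exists2 s, s < N & cmod (Cs s) = X).
    exact: (phiP R e Cs a M).1.
  have [C [k [A [S [CX card_k relA relS rep]]]]] := module_represented X.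
  have C_new s : s < nmod L -> cmod C <> cmod (Cs s).
    by move=> s_lt; rewrite CX => Xs; apply: X_new; exists s.
  have M' := models_add_mod okL okars M rep C_new.
  have /(psiP _ _ _ _ M').1 : l2_sat (env_pred (env_pred (env_card e k) A) S) psi.
    apply: sat_psi => //.
    + by rewrite /= e'N0.
    + by rewrite -[map _ _]/(map (card_of (env_card e k)) [:: N; N]) /= e'N0.
    + apply/(module_formP _ _ _ (models_ring M') (models_ord M')).
      by rewrite e'N e'p e'p1; apply: represents_graph rep.
  rewrite upd_eq CX; apply: Phi_local => s s_lt; by rewrite upd_lt.
- split=> [|k card_k A relA S relS sat_mod].
    by apply/(phiP _ _ _ _ M) => s _; apply: all_Phi.
  have G := (@module_formP R (env_pred (env_pred (env_card e k) A) S) N p p.+1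
    (models_ring M) (models_ord M)).1 sat_mod.
  rewrite e'N e'p e'p1 in G.
  (* Even if the code given here is that of an existing module, it is read as the code of a module
     outside all slots, to which [psi] applies. *)
  have [C [rep C_new]] := graph_represented (fun s => cmod (Cs s)) G.
  have M' := models_add_mod okL okars M rep (fun s _ => C_new s).
  apply/(psiP _ _ _ _ M'); rewrite upd_eq.
  by apply: Phi_local (all_Phi _) => s s_lt; rewrite upd_lt.
Qed.

(** A linear map between two coded modules is determined by its graph, so in contrast with modules
    no case distinction is made. *)
Lemma expressible_all_hom L m (ars : m.-tuple arrow_slot) d c
    (Phi : mod_pred m.+1) :
  layout_ok L -> (forall j, arrow_slot_ok L (tnth ars j)) ->
  d < nmod L -> c < nmod L ->
  expressible (add_hom L d c)
    [tuple of rcons ars (ArrowSlot d c (size (lpreds L)))] Phi ->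
  expressible L ars (fun R Ms a => forall h : mod_hom (Ms d) (Ms c),
    Phi R Ms [tuple of rcons a (@Arrow (modcat R) (Ms d) (Ms c) h)]).
Proof.
move=> okL okars d_lt c_lt [psi [wf_psi psiP]].
pose p := size (lpreds L).
pose homf := hom_form d c (ladd L d) (lscl L d) (ladd L c) (lscl L c) p.
exists (LAllPred [:: d; c] 0 (LImp homf psi)); split.
  have okL' := add_hom_ok (d := d) (c := c) okL.
  have [[ad adE] [sd sdE]] := okL' d d_lt.
  have [[ac acE] [sc scE]] := okL' c c_lt.
  have wf_hom : l2_wf (layout_ctx (add_hom L d c)) homf.
    apply: hom_form_wf => //=; first by rewrite size_rcons.
    by rewrite nth_rcons ltnn eqxx.
  suff: [&& all (fun k => k < nmod L) [:: d; c],
      l2_wf (layout_ctx (add_hom L d c)) homf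
    & l2_wf (layout_ctx (add_hom L d c)) psi] by [].
  by rewrite wf_hom wf_psi /= d_lt c_lt.
move=> R e Cs a M.
have old P q : q < size (lpreds L) -> pred_of (env_pred e P) q = pred_of e q.
  by move=> q_lt; rewrite pred_of_old // (models_pred M).
have new P : pred_of (env_pred e P) p = P.
  by rewrite -[p](models_pred M) pred_of_new.
have homfP P : l2_sat (env_pred e P) homf <->
    hom_graph (card_of e d) (card_of e c) (pred_of e (ladd L d))
      (pred_of e (lscl L d)) (pred_of e (ladd L c)) (pred_of e (lscl L c)) P.
  have [[ad _] [sd _]] := okL d d_lt; have [[ac _] [sc _]] := okL c c_lt.
  rewrite -{2}(new P) -(old P _ ad) -(old P _ sd) -(old P _ ac) -(old P _ sc).
  exact: (@hom_formP R (env_pred e P) _ _ _ _ _ _ _ (models_ring M) (models_ord M)).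
have repd := models_mod M d_lt; have repc := models_mod M c_lt.
split=> [sat_psi h|all_Phi P relP /homfP G].
- have [P relP repP] := hom_represented h repd repc.
  have M' := models_add_hom okL okars M repP.
  by apply/(psiP _ _ _ _ M'); apply: sat_psi => //; apply/homfP/(hom_represents_graph repd repc repP).
- have [h repP] := graph_hom_represented repd repc G.
  have M' := models_add_hom okL okars M repP.
  exact/(psiP _ _ _ _ M')/all_Phi.
Qed.

(** * Atomic formulas *)

(** Equal arrows have equal morphisms up to transport along equalities of their ends; with [X] and
    [Y] fixed, proof irrelevance makes these transports trivial. *)
Lemma Arrow_inj (C : category) (X Y : obj C) (f g : hom X Y) :
  Arrow f = Arrow g -> f = g.
Proof.
pose cast (a : arrow C) (eX : dom a = X) (eY : cod a = Y) : hom X Y :=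
  ecast Z (hom X Z) eY (ecast Z (hom Z (cod a)) eX (arr a)).
suff cast_eq a b eX eY eX' eY' : a = b -> cast a eX eY = cast b eX' eY'.
  exact: (cast_eq (Arrow f) (Arrow g) erefl erefl erefl erefl).
move=> ab; case: b / ab eX' eY' => eX' eY'.
by rewrite (Prop_irrelevance eX' eX) (Prop_irrelevance eY' eY).
Qed.

Section Atoms.
Context (L : layout) (n m : nat) (ars : m.-tuple arrow_slot) (obs : n.-tuple nat).
Hypothesis okars : forall j, arrow_slot_ok L (tnth ars j).
Hypothesis okobs : forall i, tnth obs i < nmod L.

Lemma expressible_CObjEq i j : expressible L ars (fun R Ms _ =>
  tnth [tuple of map Ms obs] i = tnth [tuple of map Ms obs] j).
Proof.
have [psi [wf psiP]] := expressible_bool L ars (tnth obs i == tnth obs j).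
exists psi; split=> // R e Cs a M; apply: iff_trans (psiP _ _ _ _ M) _.
rewrite !tnth_map; split=> [/eqP -> //|eq_ij]; apply/eqP.
exact: (models_inj M).
Qed.

Lemma expressible_CInMor f i j : expressible L ars (fun R Ms a =>
  dom (tnth a f) = tnth [tuple of map Ms obs] i /\
  cod (tnth a f) = tnth [tuple of map Ms obs] j).
Proof.
have [psi [wf psiP]] := expressible_bool L ars
  ((adom (tnth ars f) == tnth obs i) && (acod (tnth ars f) == tnth obs j)).
exists psi; split=> // R e Cs a M; apply: iff_trans (psiP _ _ _ _ M) _.
have [h -> _] := models_arr M f; have [d_lt c_lt _] := okars f.
rewrite !tnth_map /=; split=> [/andP[/eqP -> /eqP ->] //|[eq_d eq_c]].
by apply/andP; split; apply/eqP; apply: (models_inj M).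
Qed.

Lemma expressible_CMorEq f g :
  expressible L ars (fun R Ms a => tnth a f = tnth a g).
Proof.
have okf := okars f; have okg := okars g.
case Ef: (tnth ars f) okf => [d c p] [/= d_lt c_lt [p_lt pE]].
case Eg: (tnth ars g) okg => [d' c' q] [/= d'_lt c'_lt [q_lt qE]].
(* Arrows between different slots have different ends by [models_inj], so the atom is translated as
   false. *)
have [/eqP eq_dc|neq_dc] := boolP ((d, c) == (d', c')); last first.
  have [psi [wf psiP]] := expressible_bool L ars false.
  exists psi; split=> // R e Cs a M; apply: iff_trans (psiP _ _ _ _ M) _.
  split=> // eq_fg; case/eqP: neq_dc.
  have := models_arr M f; have := models_arr M g; rewrite Ef Eg /=.
  move=> [h' h'E _] [h hE _]; move: eq_fg; rewrite hE h'E => hh.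
  congr (_, _); apply: (models_inj M) => //.
    exact: (congr1 (@dom (modcat R)) hh).
  exact: (congr1 (@cod (modcat R)) hh).
case: eq_dc => ? ?; subst d' c'.
(* One inclusion suffices: a function whose graph lies in that of another with the same domain is
   equal to it. *)
exists (LAllOrd d (LAllOrd c (LImp (LPred p [:: 0; 1] [::]) (LPred q [:: 0; 1] [::])))).
split=> [|R e Cs a M]; first by rewrite /= d_lt c_lt p_lt q_lt pE qE /= eqxx.
have satE : l2_sat e (LAllOrd d (LAllOrd c
      (LImp (LPred p [:: 0; 1] [::]) (LPred q [:: 0; 1] [::])))) <->
    forall x, zin x (card_of e d) -> forall y, zin y (card_of e c) ->
      pred_of e p [:: x; y] [::] -> pred_of e q [:: x; y] [::].
  by case: e {M} (models_ring M) (models_ord M) => rs K os Q /= -> ->.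
apply: iff_trans satE _.
have := models_arr M f; have := models_arr M g; rewrite Ef Eg /=.
move=> [h' -> h'P] [h -> hP].
have [[_ d_in] _ _] := models_mod M d_lt; have [[_ c_in] _ _] := models_mod M c_lt.
split=> [sub|/Arrow_inj hh'].
  congr Arrow; apply: mod_hom_eq => x; apply/esym/h'P/sub; last exact/hP.
    by apply/d_in; exists x.
  by apply/c_in; exists (h x).
by move=> _ /d_in[x ->] _ /c_in[y ->] /hP <-; apply/h'P; rewrite hh'.
Qed.

Lemma expressible_CIsId f i : expressible L ars (fun R Ms a =>
  tnth a f = @Arrow (modcat R) _ _ (idm (tnth [tuple of map Ms obs] i : obj (modcat R)))).
Proof.
have okf := okars f.
case Ef: (tnth ars f) okf => [d c p] [/= d_lt c_lt [p_lt pE]].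
have := okobs i; set s := tnth obs i => s_lt.
have [/eqP eq_dc|neq_dc] := boolP ((d, c) == (s, s)); last first.
  have [psi [wf psiP]] := expressible_bool L ars false.
  exists psi; split=> // R e Cs a M; apply: iff_trans (psiP _ _ _ _ M) _.
  split=> // eq_fi; case/eqP: neq_dc.
  have := models_arr M f; rewrite Ef /= => -[h hE _].
  move: eq_fi; rewrite hE tnth_map => hh.
  congr (_, _); apply: (models_inj M) => //.
    exact: (congr1 (@dom (modcat R)) hh).
  exact: (congr1 (@cod (modcat R)) hh).
case: eq_dc => ? ?; subst d c.
(* A map on the module in slot [s] is the identity as soon as its graph contains the diagonal. *)
exists (LAllOrd s (LPred p [:: 0; 0] [::])).
split=> [|R e Cs a M]; first by rewrite /= s_lt p_lt pE /= eqxx.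
have satE : l2_sat e (LAllOrd s (LPred p [:: 0; 0] [::])) <->
    forall x, zin x (card_of e s) -> pred_of e p [:: x; x] [::].
  by case: e {M} (models_ring M) (models_ord M) => rs K os Q /= -> ->.
apply: iff_trans satE _.
have := models_arr M f; rewrite Ef tnth_map /= => -[h -> hP].
have [[_ s_in] _ _] := models_mod M s_lt.
split=> [diag|/Arrow_inj hE].
  by congr Arrow; apply: mod_hom_eq => x; apply/hP/diag/s_in; exists x.
by move=> _ /s_in[x ->]; apply/hP; rewrite hE.
Qed.

Lemma expressible_CIsComp h f g : expressible L ars (fun R Ms a =>
  exists (X Y Z : obj (modcat R)) (u : hom Y Z) (v : hom X Y),
    [/\ tnth a f = Arrow u, tnth a g = Arrow v & tnth a h = Arrow (comp u v)]).
Proof.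
have okf := okars f; have okg := okars g; have okh := okars h.
case Ef: (tnth ars f) okf => [y z p] [/= y_lt z_lt [p_lt pE]].
case Eg: (tnth ars g) okg => [x y' q] [/= x_lt y'_lt [q_lt qE]].
case Eh: (tnth ars h) okh => [x' z' r] [/= x'_lt z'_lt [r_lt rE]].
have [/eqP eq_xyz|neq_xyz] := boolP ((x', y', z') == (x, y, z)); last first.
  have [psi [wf psiP]] := expressible_bool L ars false.
  exists psi; split=> // R e Cs a M; apply: iff_trans (psiP _ _ _ _ M) _.
  split=> // -[X [Y [Z [u [v uv]]]]]; case/eqP: neq_xyz.
  have := models_arr M f; have := models_arr M g; have := models_arr M h.
  rewrite Ef Eg Eh /= => -[hh hhE _] [hg hgE _] [hf hfE _].
  case: uv; rewrite hhE hgE hfE => eq_f eq_g eq_h.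
  congr (_, _, _); apply: (models_inj M) => //.
  - exact: (etrans (congr1 (@dom (modcat R)) eq_h) (esym (congr1 (@dom (modcat R)) eq_g))).
  - exact: (etrans (congr1 (@cod (modcat R)) eq_g) (esym (congr1 (@dom (modcat R)) eq_f))).
  - exact: (etrans (congr1 (@cod (modcat R)) eq_h) (esym (congr1 (@cod (modcat R)) eq_f))).
case: eq_xyz => ? ? ?; subst x' y' z'.
(* The relational composite of the graphs of [g] and [f] lies in the graph of [h]; totality of [g]
   and [f] turns this inclusion into equality of maps. *)
pose psi := LAllOrd x (LAllOrd y (LAllOrd z (LImp (LPred q [:: 0; 1] [::])
  (LImp (LPred p [:: 1; 2] [::]) (LPred r [:: 0; 2] [::]))))).
exists psi; split=> [|R e Cs a M].
  by rewrite /= x_lt y_lt z_lt p_lt q_lt r_lt pE qE rE /= !eqxx.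
have satE : l2_sat e psi <->
    forall s, zin s (card_of e x) -> forall t, zin t (card_of e y) ->
    forall w, zin w (card_of e z) -> pred_of e q [:: s; t] [::] ->
      pred_of e p [:: t; w] [::] -> pred_of e r [:: s; w] [::].
  by case: e {M} (models_ring M) (models_ord M) => rs K os Q /= -> ->.
apply: iff_trans satE _.
have := models_arr M f; have := models_arr M g; have := models_arr M h.
rewrite Ef Eg Eh /= => -[hh -> hhP] [hg -> hgP] [hf -> hfP].
have [[_ x_in] _ _] := models_mod M x_lt.
have [[_ y_in] _ _] := models_mod M y_lt.
have [[_ z_in] _ _] := models_mod M z_lt.
split=> [sub|[X [Y [Z [u [v [eq_f eq_g eq_h]]]]]]].
  exists (cmod (Cs x)), (cmod (Cs y)), (cmod (Cs z)), hf, hg; split=> //.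
  congr Arrow; apply: mod_hom_eq => s; apply/hhP.
  apply: (sub _ _ (cenc (Cs y) (hg s))); try exact/hgP; try exact/hfP.
  - by apply/x_in; exists s.
  - by apply/y_in; exists (hg s).
  - by apply/z_in; exists (hf (hg s)).
have eX : cmod (Cs x) = X := congr1 (@dom (modcat R)) eq_g.
have eY : cmod (Cs y) = Y := congr1 (@dom (modcat R)) eq_f.
have eZ : cmod (Cs z) = Z := congr1 (@cod (modcat R)) eq_f.
subst X Y Z; move: eq_h.
rewrite -(Arrow_inj eq_f) -(Arrow_inj eq_g) => /Arrow_inj hhE.
move=> _ /x_in[s ->] _ /y_in[t ->] _ /z_in[w ->] /hgP <- /hfP <-.
by apply/hhP; rewrite hhE.
Qed.

End Atoms.

(** * Translation of all formulas of category theory *)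

Lemma map_tuple_rcons (T U : Type) (f : T -> U) n (t : n.-tuple T) x :
  [tuple of map f [tuple of rcons t x]] = [tuple of rcons [tuple of map f t] (f x)].
Proof. by apply: val_inj; rewrite /= map_rcons. Qed.

Lemma map_tuple_eq (T U : Type) (P : pred T) (f g : T -> U) n (t : n.-tuple T) :
  (forall i, P (tnth t i)) -> (forall x, P x -> f x = g x) ->
  [tuple of map f t] = [tuple of map g t].
Proof. by move=> Pt fg; apply: eq_from_tnth => i; rewrite !tnth_map fg. Qed.

Lemma tnth_rcons_lt (n N : nat) (t : n.-tuple nat) s :
  (forall i, tnth t i < N) -> s < N ->
  forall i, tnth [tuple of rcons t s] i < N.
Proof.
move=> t_lt s_lt i; have /allP : all (fun x => x < N) (rcons t s).
  by rewrite all_rcons s_lt; apply/allP => x /tnthP[j ->].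
by apply; apply: (mem_tnth i [tuple of rcons t s]).
Qed.

Section Quantifiers.
Context (n m : nat).

(** All layouts and all assignments of slots are quantified over, because the body of a quantifier
    is translated in several of them: once for each existing slot and once for a new one. *)
Definition cat_expressible (Theta : forall C : category,
    n.-tuple (obj C) -> m.-tuple (arrow C) -> Prop) : Prop :=
  forall L (ars : m.-tuple arrow_slot) (obs : n.-tuple nat),
  layout_ok L -> (forall j, arrow_slot_ok L (tnth ars j)) ->
  (forall i, tnth obs i < nmod L) ->
  expressible L ars (fun R Ms a => Theta (modcat R) [tuple of map Ms obs] a).

End Quantifiers.

Lemma cat_expressible_all_obj n m Theta :
  @cat_expressible n.+1 m Theta ->
  cat_expressible (fun C o a => forall X, Theta C [tuple of rcons o X] a).
Proof.
move=> expT L ars obs okL okars okobs.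
apply: (@expressible_all_mod _ _ _ (fun R X Ms a =>
  Theta (modcat R) [tuple of rcons [tuple of map Ms obs] X] a)) => //.
- by move=> R X Ms Ms' a eq_Ms; rewrite (map_tuple_eq okobs eq_Ms).
- move=> s s_lt; have := expT L ars [tuple of rcons obs s] okL okars.
  move/(_ (tnth_rcons_lt okobs s_lt)); apply: expressible_ext => R Ms a.
  by rewrite map_tuple_rcons.
- have := expT _ ars [tuple of rcons obs (nmod L)] (add_mod_ok okL).
  move/(_ (fun j => add_mod_arrow_ok (okars j))).
  have okobs' i : tnth [tuple of rcons obs (nmod L)] i < nmod (add_mod L).
    by apply: tnth_rcons_lt => // j; apply: leqW.
  move/(_ okobs'); apply: expressible_ext => R Ms a.
  by rewrite map_tuple_rcons.
Qed.

(** An arrow is a domain, a codomain and a linear map between them, so its quantifier becomes two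
    over modules followed by one over graphs. *)
Lemma cat_expressible_all_mor n m Theta :
  @cat_expressible n m.+1 Theta ->
  cat_expressible (fun C o a => forall f, Theta C o [tuple of rcons a f]).
Proof.
move=> expT L ars obs okL okars okobs.
(* The layout is arbitrary because the domain and the codomain may each have added a slot by
   then. *)
have exp_hom L' d c : layout_ok L' -> (forall j, arrow_slot_ok L' (tnth ars j)) ->
    (forall i, tnth obs i < nmod L') -> d < nmod L' -> c < nmod L' ->
    expressible L' ars (fun R Ms a => forall h : mod_hom (Ms d) (Ms c),
      Theta (modcat R) [tuple of map Ms obs]
        [tuple of rcons a (@Arrow (modcat R) (Ms d) (Ms c) h)]).
  move=> okL' okars' okobs' d_lt c_lt.
  apply: (@expressible_all_hom _ _ _ _ _
    (fun R Ms a => Theta (modcat R) [tuple of map Ms obs] a)) => //.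
  apply: expT => //; first exact: add_hom_ok.
  apply: arrow_slot_ok_rcons => [j|]; first exact: add_hom_arrow_ok.
  by split=> //; split; rewrite /= ?size_rcons // nth_rcons ltnn eqxx.
have exp_cod L' d : layout_ok L' -> (forall j, arrow_slot_ok L' (tnth ars j)) ->
    (forall i, tnth obs i < nmod L') -> d < nmod L' ->
    expressible L' ars (fun R Ms a => forall Y (h : mod_hom (Ms d) Y),
      Theta (modcat R) [tuple of map Ms obs]
        [tuple of rcons a (@Arrow (modcat R) (Ms d) Y h)]).
  move=> okL' okars' okobs' d_lt.
  apply: (@expressible_all_mod _ _ _ (fun R Y Ms a => forall h : mod_hom (Ms d) Y,
      Theta (modcat R) [tuple of map Ms obs]
        [tuple of rcons a (@Arrow (modcat R) (Ms d) Y h)])) => //.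
  - by move=> R Y Ms Ms' a eq_Ms; rewrite (map_tuple_eq okobs' eq_Ms) (eq_Ms d).
  - by move=> s s_lt; apply: exp_hom.
  - apply: exp_hom; rewrite /= ?ltnS //; [exact: add_mod_ok|..].
    + by move=> j; apply: add_mod_arrow_ok.
    + by move=> i; apply: leqW; apply: okobs'.
    + exact: ltnW.
suff: expressible L ars (fun R Ms a => forall X Y (h : mod_hom X Y),
    Theta (modcat R) [tuple of map Ms obs]
      [tuple of rcons a (@Arrow (modcat R) X Y h)]).
  apply: expressible_ext => R Ms a; split=> [all_h [X Y h]|all_f X Y h].
    exact: all_h.
  exact: all_f.
apply: (@expressible_all_mod _ _ _ (fun R X Ms a => forall Y (h : mod_hom X Y),
    Theta (modcat R) [tuple of map Ms obs]
      [tuple of rcons a (@Arrow (modcat R) X Y h)])) => //.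
- by move=> R X Ms Ms' a eq_Ms; rewrite (map_tuple_eq okobs eq_Ms).
- by move=> s s_lt; apply: exp_cod.
- apply: exp_cod; rewrite /= ?ltnS //; [exact: add_mod_ok|..].
  + by move=> j; apply: add_mod_arrow_ok.
  + by move=> i; apply: leqW; apply: okobs.
Qed.

Lemma cat_expressible_not n m Theta : @cat_expressible n m Theta ->
  cat_expressible (fun C o a => ~ Theta C o a).
Proof.
move=> expT L ars obs okL okars okobs.
exact: expressible_not (expT L ars obs okL okars okobs).
Qed.

Lemma cat_expressible_ext n m Theta Theta' :
  (forall C o a, Theta C o a <-> Theta' C o a) ->
  @cat_expressible n m Theta -> cat_expressible Theta'.
Proof.
move=> TT' expT L ars obs okL okars okobs.
by apply: expressible_ext (expT L ars obs okL okars okobs) => R Ms a; apply: TT'.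
Qed.

Lemma not_forall_not (T : Type) (P : T -> Prop) :
  (~ forall x, ~ P x) <-> exists x, P x.
Proof.
by split=> [NP|[x Px] NP]; [apply: contrapT => /forallNP | apply: NP Px].
Qed.

(** Induction on the formula; existential quantifiers are reduced to universal ones by classical
    duality. *)
Lemma cat_sat_expressible n m (phi : cat_form n m) :
  cat_expressible (fun C o a => @cat_sat C n m phi o a).
Proof.
elim: n m / phi => /=.
- by move=> n m i j L ars obs _ _ okobs; apply: expressible_CObjEq.
- by move=> n m f g L ars obs _ okars _; apply: expressible_CMorEq.
- by move=> n m f i j L ars obs _ okars okobs; apply: expressible_CInMor.
- by move=> n m h f g L ars obs _ okars _; apply: expressible_CIsComp.
- by move=> n m f i L ars obs _ okars okobs; apply: expressible_CIsId.
- by move=> n m phi /cat_expressible_not.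
- move=> n m phi expphi psi exppsi L ars obs okL okars okobs.
  exact: expressible_and (expphi L ars obs _ _ _) (exppsi L ars obs _ _ _).
- move=> n m phi expphi psi exppsi L ars obs okL okars okobs.
  exact: expressible_or (expphi L ars obs _ _ _) (exppsi L ars obs _ _ _).
- move=> n m phi expphi psi exppsi L ars obs okL okars okobs.
  exact: expressible_imp (expphi L ars obs _ _ _) (exppsi L ars obs _ _ _).
- by move=> n m phi /cat_expressible_all_obj.
- move=> n m phi /cat_expressible_not/cat_expressible_all_obj/cat_expressible_not.
  by apply: cat_expressible_ext => C o a; apply: not_forall_not.
- by move=> n m phi /cat_expressible_all_mor.
- move=> n m phi /cat_expressible_not/cat_expressible_all_mor/cat_expressible_not.
  by apply: cat_expressible_ext => C o a; apply: not_forall_not.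
Qed.

(** A concrete module with which to fill the family of codes over the empty layout, since that
    family is a total function on slots. *)
Definition regular_module (R : zring) : module R :=
  @Module R (ring_set R) (0 : R)%R (@GRing.opp R) (@GRing.add R) (@GRing.mul R)
    (@addrA R) (@addrC R) (@add0r R) (@addNr R) (@mulrA R) (@mul1r R)
    (@mulrDr R) (fun x a b => mulrDl a b x).

Theorem theorem9 (R S : zring) :
  l2_equivalent R S -> elementarily_equivalent (modcat R) (modcat S).
Proof.
move=> equiv phi.
pose L0 := Layout 0 [::] id id.
have [||| psi [wf psiP]] := @cat_sat_expressible 0 0 phi L0 [tuple] [tuple].
- by [].
- by case.
- by case.
have satP (T : zring) :
    l2_sat (l2_env0 T) psi <-> @cat_sat (modcat T) 0 0 phi [tuple] [tuple].
  pose Cs (_ : nat) := Coded (fun x : elt (mod_set (regular_module T)) => sval x).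
  have M : @models L0 0 [tuple] T (l2_env0 T) Cs [tuple] by split=> // -[].
  apply: iff_trans (psiP _ _ _ _ M) _.
  by rewrite [X in cat_sat phi X _](tuple0 _).
(* The context of [L0] computes to [l2_ctx0], so [wf] says that [psi] is a sentence. *)
by rewrite -!satP; apply: equiv.
Qed.
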